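(* Let $n\ge 1$ be an integer, and let $a=(0,0,\dots,0,0)$ and $b=(0,0,\dots,0,1)$ be vertices of the $n$-dimensional hypercube $\{0,1\}^n$ (so $a$ and $b$ differ only in the last coordinate). Let $x=(x_1,x_2,\dots,x_n)\in\{0,1\}^n$ be any vertex, and let $k=x_1+x_2+\dots+x_{n-1}$. Let $(X_t)_{t\ge 0}$ be the simple random walk on the hypercube started at $X_0=x$, let $\tau=\inf\{t\ge 0:\ X_t=a \text{ or } X_t=b\}$, and let $p_{a,b}(x)=\mathbb{P}(X_\tau=b\mid X_0=x)$ be the probability that the walk hits $b$ before $a$. Then $$ p_{a,b}(x)=\begin{cases} \dfrac12-\dfrac{\sum_{i=k+1}^{n}\binom{n}{i}}{2(2^n-1)\binom{n-1}{k}}, & \text{if } x_n=0,\\[3ex] \dfrac12+\dfrac{\sum_{i=k+1}^{n}\binom{n}{i}}{2(2^n-1)\binom{n-1}{k}}, & \text{if } x_n=1. \end{cases} $$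
   Context: The $n$-dimensional hypercube is the graph with vertex set $\{0,1\}^n$ in which two vertices $x=(x_1,\dots,x_n)$ and $y=(y_1,\dots,y_n)$ are joined by an edge if and only if $\sum_{i=1}^n|x_i-y_i|=1$, i.e. they differ in exactly one coordinate. The simple random walk on the hypercube is the Markov chain on $\{0,1\}^n$ that at each step moves from the current vertex to each of its $n$ neighbours with probability $1/n$, independently of the past. Time $t=0$ is included in the definition of the hitting time $\tau$. *)

(* Defs.v *)
From HB Require Import structures.
From mathcomp Require Import all_boot all_order all_algebra.
From mathcomp Require Import all_classical all_reals all_analysis.

Set Implicit Arguments.
Unset Strict Implicit.
Unset Printing Implicit Defensive.

Import Order.TTheory GRing.Theory Num.Theory.

Local Open Scope classical_set_scope.
Local Open Scope ring_scope.

Definition vertex (n : nat) : Type := {ffun 'I_n -> bool}.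

HB.instance Definition _ (n : nat) := Finite.on (vertex n).
HB.instance Definition _ (n : nat) :=
  isPointed.Build (vertex n) [ffun=> false].
HB.instance Definition _ (n : nat) :=
  @isMeasurable.Build default_measure_display (vertex n)
    discrete_measurable discrete_measurable0
    discrete_measurableC discrete_measurableU.

Definition bit (n : nat) (x : vertex n) (i : 'I_n) : bool :=
  (x : {ffun 'I_n -> bool}) i.

Definition cube_edge (n : nat) : rel (vertex n) := fun x y =>
  (\sum_(i < n) `|(bit x i : nat) - (bit y i : nat)|)%N == 1%N.

Lemma last_coord_subproof (n : nat) : (1 <= n)%N -> (n.-1 < n)%N.
Proof. by case: n. Qed.

Definition last_coord (n : nat) (hn : (1 <= n)%N) : 'I_n :=
  Ordinal (last_coord_subproof hn).

Definition vertex_a (n : nat) : vertex n := [ffun=> false].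

Definition vertex_b (n : nat) (hn : (1 <= n)%N) : vertex n :=
  [ffun i => i == last_coord hn].

(* P(A | B); the value is the junk 0 when P B = 0 *)
Definition cond_prob d (T : measurableType d) (R : realType)
    (P : probability T R) (A B : set T) : R :=
  fine (P (A `&` B)) / fine (P B).

Definition transition (R : realType) (n : nat) (x y : vertex n) : R :=
  if cube_edge x y then n%:R^-1 else 0.

(* The Markov property is stated for every history h 0, ..., h t of positive
   probability; the values h s for s > t are irrelevant. *)
Definition simple_random_walk d (T : measurableType d) (R : realType)
    (P : probability T R) (n : nat) (X : nat -> {RV P >-> vertex n})
    (x : vertex n) : Prop :=
  P [set w | X 0%N w = x] = 1%E /\
  forall (t : nat) (h : nat -> vertex n) (y : vertex n),
    let history := [set w | forall s, (s <= t)%N -> X s w = h s] in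
    P history != 0%E ->
    cond_prob P [set w | X t.+1 w = y] history = transition R (h t) y.

(* +oo on the trajectories that never meet A *)
Definition hitting_time (R : realType) (T V : Type) (X : nat -> T -> V)
    (A : set V) (w : T) : \bar R :=
  ereal_inf [set (t%:R%:E : \bar R) | t in [set t : nat | A (X t w)]].

(* the event that the time tau is finite and X is at v at that time *)
Definition at_time_event (R : realType) (T V : Type) (X : nat -> T -> V)
    (tau : T -> \bar R) (v : V) : set T :=
  [set w | exists2 t : nat, tau w = t%:R%:E & X t w = v].

Definition hit_prob d (T : measurableType d) (R : realType)
    (P : probability T R) (n : nat) (X : nat -> {RV P >-> vertex n})
    (a b x : vertex n) : R :=
  let Y : nat -> T -> vertex n := fun t => X t in
  let tau := hitting_time R Y [set a; b] in
  cond_prob P (at_time_event Y tau b) [set w | X 0%N w = x].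

Arguments simple_random_walk {d T R} P {n} X x.
Arguments hit_prob {d T R} P {n} X a b x.

(* Main.v *)
(* Write e(k) for the claimed excess, so that p = 1/2 -+ e(k) according to the
   last bit.  Since (n+1) e(k) = k e(k-1) + (n-1-k) e(k+1) for 0 < k < n, the
   claimed function is harmonic for the walk off {a, b} and it equals 0 at a and
   1 at b.  Hence P(b hit first by time t) + E[p(X_t); a, b not hit by time t] is
   constant in t, equal to p(x).  Its second term vanishes as t grows because
   1 - (n+1)^-|y|, with |y| the number of ones of y, decreases in mean by at
   least a fixed amount at each step taken from a vertex other than a. *)
Require Import Defs.
From mathcomp Require Import all_boot all_order all_algebra.
From mathcomp Require Import all_classical all_reals all_analysis.
From mathcomp Require Import ring lra zify.

Set Implicit Arguments.
Unset Strict Implicit.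
Unset Printing Implicit Defensive.

Import Order.TTheory GRing.Theory Num.Theory.

Local Open Scope classical_set_scope.
Local Open Scope ring_scope.

(** * Real-valued probabilities and the law of total probability *)

Section RealProbability.
Context d (T : measurableType d) (R : realType) (P : probability T R).

(** Probabilities are finite, so [fine] loses nothing, and the real value gives access to [ring] and
    [lra]. *)
Definition pr (A : set T) : R := fine (P A).

Lemma prE (A : set T) : measurable A -> P A = (pr A)%:E.
Proof. by move=> mA; rewrite /pr fineK// fin_num_measure. Qed.

Lemma pr_ge0 (A : set T) : 0 <= pr A.
Proof. exact/fine_ge0/measure_ge0. Qed.

Lemma pr_set0 : pr set0 = 0.
Proof. by rewrite /pr measure0. Qed.

Lemma le_pr (A B : set T) :
  measurable A -> measurable B -> A `<=` B -> pr A <= pr B.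
Proof.
move=> mA mB AB; rewrite -lee_fin -!prE//.
by apply: le_measure => //; rewrite inE.
Qed.

Lemma pr_setU (A B : set T) : measurable A -> measurable B ->
  A `&` B = set0 -> pr (A `|` B) = pr A + pr B.
Proof.
move=> mA mB AB; apply: EFin_inj.
by rewrite EFinD -!prE ?measureU//; exact: measurableU.
Qed.

Lemma pr_setI_full (A B : set T) : measurable A -> measurable B ->
  P B = 1%E -> pr (A `&` B) = pr A.
Proof.
move=> mA mB PB.
have nB : pr (~` B) = 0 by rewrite /pr probability_setC// PB subee.
have mAB : measurable (A `&` ~` B) by apply: measurableI => //; exact: measurableC.
have AB0 : pr (A `&` ~` B) = 0.
  by apply/eqP; rewrite eq_le pr_ge0 andbT -nB le_pr//; exact: measurableC.
rewrite -[in RHS](setIT A) -(setUv B) setIUr pr_setU ?AB0 ?addr0//.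
  exact: measurableI.
by rewrite setIACA setICr setI0.
Qed.

Section FiniteValued.
Variables (I : finType) (Z : T -> I).
Hypothesis mZ : forall i, measurable (Z @^-1` [set i]).

Lemma measurable_fin_preimage (A : set I) : measurable (Z @^-1` A).
Proof.
rewrite (_ : _ @^-1` A = \bigcup_(i in A) (Z @^-1` [set i])).
  by apply: fin_bigcup_measurable => // i _; exact: mZ.
apply/seteqP; split=> [w Aw|w [i Ai /= Zi]]; first by exists (Z w).
by rewrite /preimage/= Zi.
Qed.

Lemma pr_partition (A : set T) : measurable A ->
  pr A = \sum_(i : I) pr (A `&` Z @^-1` [set i]).
Proof.
move=> mA; apply: EFin_inj; rewrite -prE// -sumEFin.
rewrite (eq_bigr (fun i => P (A `&` Z @^-1` [set i]))); last first.
  by move=> i _; rewrite -prE//; apply: measurableI.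
rewrite fsbig_seq ?index_enum_uniq//= -measure_fin_bigcup//=.
- congr (P _); apply/seteqP; split=> [w Aw|w [i _ []]//].
  by exists (Z w) => //=; rewrite mem_index_enum.
- by move=> i j _ _ [w [[_ <-] [_ <-]]].
- by move=> i _; apply: measurableI.
Qed.

End FiniteValued.

End RealProbability.

(** * Finite Markov chains observed until they enter a set [D] *)

Section FiniteChain.
Context d (T : measurableType d) (R : realType) (P : probability T R).
Variables (V : finType) (X : nat -> T -> V) (K : V -> V -> R).
Hypothesis mX : forall t v, measurable (X t @^-1` [set v]).

Local Notation pr := (pr P).

(** The past is packed into one variable with finitely many values, so every event about it is a
    preimage and can be split with [pr_partition]. *)
Definition history t (w : T) : {ffun 'I_t.+1 -> V} := [ffun i => X (val i) w].

Lemma measurable_history t p : measurable (history t @^-1` [set p]).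
Proof.
rewrite (_ : _ @^-1` _ = \bigcap_(i in [set: 'I_t.+1]) (X i @^-1` [set p i])).
  by apply: fin_bigcap_measurable => // i _.
apply/seteqP; split=> [w /= <- i _|w Xp /=]; first by rewrite ffunE.
by apply/ffunP => i; rewrite ffunE Xp.
Qed.

(** The Markov property in product form, which stays meaningful on histories of probability zero. *)
Hypothesis markov : forall t (p : {ffun 'I_t.+1 -> V}) z,
  pr (history t @^-1` [set p] `&` X t.+1 @^-1` [set z]) =
  pr (history t @^-1` [set p]) * K (p ord_max) z.

(** Split over complete histories: those in [A] that end at [y] all carry the same factor [K y z],
    and the others contribute zero to both sides. *)
Lemma markov_history t (A : set {ffun 'I_t.+1 -> V}) y z :
  pr (history t @^-1` A `&` X t @^-1` [set y] `&` X t.+1 @^-1` [set z]) =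
  pr (history t @^-1` A `&` X t @^-1` [set y]) * K y z.
Proof.
have mH B : measurable (history t @^-1` B).
  exact/measurable_fin_preimage/measurable_history.
rewrite (pr_partition P (@measurable_history t)); last first.
  by do !apply: measurableI.
rewrite [in RHS](pr_partition P (@measurable_history t)); last first.
  exact: measurableI.
rewrite mulr_suml; apply: eq_bigr => p _.
have Xt w : history t w = p -> X t w = p ord_max by move=> <-; rewrite ffunE.
have [[Ap py]|nAp] := pselect (A p /\ p ord_max = y).
  have -> : history t @^-1` A `&` X t @^-1` [set y] `&` history t @^-1` [set p]
            = history t @^-1` [set p].
    apply/seteqP; split=> [w []//|w /= wp]; split=> //.
    by split; [rewrite /= wp|rewrite /= (Xt _ wp)].
  rewrite setIAC -py -markov; congr (pr (_ `&` _)).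
  apply/seteqP; split=> [w []//|w /= wp]; split=> //.
  by split; [rewrite /= wp|rewrite /= (Xt _ wp)].
have E : history t @^-1` A `&` X t @^-1` [set y] `&` history t @^-1` [set p]
         = set0.
  apply/seteqP; split=> // w [[/= Aw Xw] wp]; apply: nAp.
  by rewrite -Xw (Xt _ wp) -wp.
by rewrite setIAC E set0I !pr_set0 mul0r.
Qed.

Variable D : {pred V}.

Definition survive t := [set w | forall s, (s <= t)%N -> X s w \notin D].

Definition first_hit b t :=
  [set w | X t w = b /\ forall s, (s < t)%N -> X s w \notin D].

Lemma surviveE t : survive t =
  history t @^-1` [set p | forall i, p i \notin D].
Proof.
apply/seteqP; split=> w /= wD => [i|s st]; first by rewrite ffunE wD// -ltnS ltn_ord.
by have := wD (Ordinal (st : (s < t.+1)%N)); rewrite ffunE.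
Qed.

Lemma measurable_survive t : measurable (survive t).
Proof.
by rewrite surviveE; exact/measurable_fin_preimage/measurable_history.
Qed.

Lemma first_hit0 b : first_hit b 0 = X 0 @^-1` [set b].
Proof.
by apply/seteqP; split=> [w []|w ?].
Qed.

Lemma first_hitS b t : first_hit b t.+1 = survive t `&` X t.+1 @^-1` [set b].
Proof.
by apply/seteqP; split=> w /= [? ?]; split.
Qed.

Lemma measurable_first_hit b t : measurable (first_hit b t).
Proof.
case: t => [|t]; first by rewrite first_hit0.
by rewrite first_hitS; apply: measurableI => //; exact: measurable_survive.
Qed.

(** The law of [X t] restricted to paths outside [D] up to and including time [t]; its total mass is
    the survival probability. *)
Definition alive t y := pr (survive t `&` X t @^-1` [set y]).

Lemma alive_ge0 t y : 0 <= alive t y.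
Proof. exact: pr_ge0. Qed.

Lemma alive_hit t y : y \in D -> alive t y = 0.
Proof.
move=> yD; rewrite /alive (_ : _ `&` _ = set0) ?pr_set0//.
apply/seteqP; split=> // w [/(_ t (leqnn t)) + /= wy].
by rewrite wy yD.
Qed.

Lemma survive_alive t : pr (survive t) = \sum_y alive t y.
Proof. exact/pr_partition/measurable_survive. Qed.

(** Here [z] may lie in [D]: the same formula gives the mass that stays alive and the mass that
    first hits [b]. *)
Lemma survive_step t z :
  pr (survive t `&` X t.+1 @^-1` [set z]) = \sum_y alive t y * K y z.
Proof.
rewrite (pr_partition P (mX t)); last first.
  by apply: measurableI => //; exact: measurable_survive.
apply: eq_bigr => y _; rewrite setIAC /alive surviveE.
exact: markov_history.
Qed.

Lemma alive0 y : y \notin D -> alive 0 y = pr (X 0 @^-1` [set y]).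
Proof.
move=> yD; congr pr; apply/seteqP; split=> [w []//|w /= wy]; split=> // s.
by rewrite leqn0 => /eqP ->; rewrite wy.
Qed.

Lemma aliveS t z : z \notin D -> alive t.+1 z = \sum_y alive t y * K y z.
Proof.
move=> zD; rewrite -survive_step; congr pr; apply/seteqP; split=> w [wD Xz].
  by split=> // s st; apply: wD; apply: leqW.
split=> // s; rewrite leq_eqVlt ltnS => /predU1P[->|/wD//].
by rewrite /= in Xz; rewrite Xz.
Qed.

Lemma survive_decreasing t : pr (survive t.+1) <= pr (survive t).
Proof.
apply: le_pr; do ?exact: measurable_survive.
by move=> w wD s st; apply/wD/leqW.
Qed.

(** * Survival probabilities vanish under a strict drift *)

Section Escape.
Variables (g : V -> R) (eps : R).
Hypothesis g_ge0 : forall v, 0 <= g v.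
Hypothesis eps_gt0 : 0 < eps.
Hypothesis drift :
  forall y, y \notin D -> \sum_z K y z * g z <= g y - eps.
Hypothesis K_ge0 : forall y z, 0 <= K y z.

(** Mass entering [D] is dropped, which can only lower the sum since [g] is nonnegative; each
    surviving unit of mass loses at least [eps]. *)
Lemma drift_alive t :
  \sum_y alive t.+1 y * g y <= \sum_y alive t y * g y - eps * pr (survive t).
Proof.
apply: (@le_trans _ _ (\sum_z (\sum_y alive t y * K y z) * g z)).
  apply: ler_sum => z _; have [zD|zD] := boolP (z \in D).
    rewrite alive_hit// mul0r mulr_ge0// sumr_ge0// => y _.
    by rewrite mulr_ge0// alive_ge0.
  by rewrite aliveS.
rewrite survive_alive mulr_sumr -sumrB.
under eq_bigr do rewrite mulr_suml.
rewrite exchange_big/=; apply: ler_sum => y _.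
under eq_bigr do rewrite -mulrA.
rewrite -mulr_sumr [eps * _]mulrC -mulrBr.
have [yD|yD] := boolP (y \in D); first by rewrite alive_hit// !mul0r.
by rewrite ler_wpM2l ?alive_ge0 ?drift.
Qed.

(** Each of the first [t] steps costs at least [eps * pr (survive t)], because survival decreases in
    time, while the remaining mean of [g] is nonnegative. *)
Lemma survive_bound t :
  t%:R * (eps * pr (survive t)) <= \sum_y alive 0 y * g y.
Proof.
suff: \sum_y alive t y * g y + t%:R * (eps * pr (survive t)) <=
      \sum_y alive 0 y * g y.
  by apply: le_trans; rewrite lerDr sumr_ge0// => y _; rewrite mulr_ge0 ?alive_ge0.
elim: t => [|t]; first by rewrite mul0r addr0.
apply: le_trans; have Dt := drift_alive t.
have := ler_wpM2l (ltW eps_gt0) (survive_decreasing t).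
have /ler_wpM2l := ler0n R t.+1 => /[apply] St.
by rewrite -natr1 in St *; lra.
Qed.

Lemma survive_lt e : 0 < e -> exists t, pr (survive t) < e.
Proof.
move=> e0; pose G := \sum_y alive 0 y * g y.
have ee : 0 < e * eps by rewrite mulr_gt0.
have [t Gt] : exists t : nat, G < t%:R * (e * eps).
  by exists (Num.truncn (G / (e * eps))).+1; rewrite -ltr_pdivrMr// truncnS_gt.
exists t; rewrite ltNge; apply/negP => le_e.
have := survive_bound t; apply/negP; rewrite -ltNge -/G; apply: (lt_le_trans Gt).
by rewrite ler_wpM2l// mulrC ler_pM2l.
Qed.

End Escape.

Lemma measurable_bigcup_first_hit b : measurable (\bigcup_t first_hit b t).
Proof. by apply: bigcupT_measurable => t; exact: measurable_first_hit. Qed.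

(** * Hitting probabilities from harmonic functions *)

Section Harmonic.
Variables (b : V) (h : V -> R).
Hypothesis bD : b \in D.
Hypothesis h_boundary : forall v, v \in D -> h v = (v == b)%:R.
Hypothesis harmonic :
  forall y, y \notin D -> \sum_z K y z * h z = h y.

Let hit_by t := \bigcup_(s in `I_t.+1) first_hit b s.

Let measurable_hit_by t : measurable (hit_by t).
Proof. by apply: bigcup_measurable => s _; exact: measurable_first_hit. Qed.

Let boundary_sum (f : V -> R) :
  \sum_v f v * h v = f b + \sum_(v | v \notin D) f v * h v.
Proof.
rewrite (bigID [in D])/= (bigD1 b)//= h_boundary// eqxx mulr1.
rewrite [X in _ + X + _]big1 ?addr0// => v /andP[vD /negbTE vb].
by rewrite h_boundary// vb mulr0.
Qed.

Let alive_sum t : \sum_y alive t y * h y = \sum_(v | v \notin D) alive t v * h v.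
Proof. by rewrite boundary_sum alive_hit ?add0r. Qed.

(** Optional stopping at a fixed time. In one step, mass reaching [b] joins [hit_by], mass reaching
    the rest of [D] has value 0 under [h], and harmonicity off [D] conserves the total. *)
Lemma stopped_harmonic t :
  pr (hit_by t) + \sum_y alive t y * h y =
  \sum_y pr (X 0 @^-1` [set y]) * h y.
Proof.
elim: t => [|t <-].
  rewrite alive_sum [RHS]boundary_sum; congr (_ + _).
    by rewrite /hit_by (_ : `I_1 = [set 0%N]) ?bigcup_set1 ?first_hit0// II1.
  by apply: eq_bigr => y yD; rewrite alive0.
have -> : hit_by t.+1 = hit_by t `|` first_hit b t.+1.
  rewrite /hit_by; apply/seteqP; split=> [w [s /=]|w [[s /= st ws]|]].
  - by rewrite ltnS leq_eqVlt => /predU1P[-> ?|? ?]; [right|left; exists s].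
  - by exists s => //=; apply: ltnW.
  - by exists t.+1 => /=.
rewrite pr_setU//; last 2 first.
- exact: measurable_first_hit.
- apply/seteqP; split=> // w [[s /= st [ws _]] [_ /(_ s st)]].
  by rewrite ws bD.
rewrite -addrA; congr (_ + _).
rewrite first_hitS survive_step (alive_sum t.+1).
under [X in _ + X]eq_bigr => z zD do rewrite aliveS//.
rewrite -(boundary_sum (fun z => \sum_y alive t y * K y z)).
under eq_bigr do rewrite mulr_suml.
rewrite exchange_big/=; apply: eq_bigr => y _.
under eq_bigr do rewrite -mulrA.
rewrite -mulr_sumr; have [yD|yD] := boolP (y \in D).
  by rewrite alive_hit// !mul0r.
by rewrite harmonic.
Qed.

Lemma hit_survive t : pr (\bigcup_s first_hit b s) <= pr (hit_by t) + pr (survive t).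
Proof.
have mS := measurable_survive t.
have -> : pr (hit_by t) + pr (survive t) = pr (hit_by t `|` survive t).
  rewrite pr_setU//; apply/seteqP; split=> // w [[s /= st [ws _]] /(_ s st)].
  by rewrite ws bD.
apply: le_pr => //.
- exact: measurable_bigcup_first_hit.
- exact: measurableU.
move=> w [s _ [ws wD]]; have [st|ts] := leqP s t; first by left; exists s.
by right=> r rt; apply: wD; apply: leq_ltn_trans ts.
Qed.

(** At time [t] both the hits still to come and the alive term are at most a constant times the
    survival probability, which gets arbitrarily small. *)
Lemma hitting_harmonic :
  (forall e, 0 < e -> exists t, pr (survive t) < e) ->
  pr (\bigcup_t first_hit b t) = \sum_y pr (X 0 @^-1` [set y]) * h y.
Proof.
move=> escape; set H := pr _; set S := \sum_y _.
pose C : R := \sum_y `|h y|.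
have C0 : 0 <= C by apply: sumr_ge0.
have dist t : `|H - S| <= (1 + C) * pr (survive t).
  rewrite /S -(stopped_harmonic t) opprD addrA mulrDl mul1r.
  apply: le_trans (ler_normB _ _) _; apply: lerD.
    rewrite ger0_norm ?subr_ge0.
      by rewrite lerBlDl hit_survive.
    apply: le_pr => //; first exact: measurable_bigcup_first_hit.
    by move=> w [s _ ws]; exists s.
  apply: le_trans (ler_norm_sum _ _ _) _.
  rewrite /C mulr_suml; apply: ler_sum => y _.
  rewrite normrM mulrC ler_wpM2l// ger0_norm ?alive_ge0// le_pr//.
  - by apply: measurableI => //; exact: measurable_survive.
  - exact: measurable_survive.
apply/eqP; rewrite -subr_eq0 -normr_le0 leNgt; apply/negP => HS.
have C1 : 0 < 1 + C by rewrite ltr_wpDr.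
have [t] := escape _ (divr_gt0 HS C1).
by rewrite ltr_pdivlMr// mulrC ltNge dist.
Qed.

End Harmonic.

End FiniteChain.

(** * Neighbours and weights in the hypercube *)

Section Cube.
Variable n : nat.
Implicit Types (x y : vertex n) (i : 'I_n) (Q : pred 'I_n).

Definition flip y i : vertex n := [ffun j => (j == i) (+) bit y j].

Lemma bit_flip y i j : bit (flip y i) j = (j == i) (+) bit y j.
Proof. by rewrite /bit/flip ffunE. Qed.

Lemma flip_inj y : injective (flip y).
Proof.
move=> i j /(congr1 (fun z : vertex n => bit z i)); rewrite !bit_flip eqxx => /eqP.
by rewrite (inj_eq (@addIb _)) eq_sym eqb_id => /eqP.
Qed.

Lemma vertexP x y : (forall i, bit x i = bit y i) -> x = y.
Proof. by move=> xy; apply/ffunP. Qed.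

Lemma cube_edgeE x y : cube_edge x y = (y \in [set flip x i | i : 'I_n]%SET).
Proof.
rewrite /cube_edge.
have -> : (\sum_(i < n) `|(bit x i : nat) - (bit y i : nat)|)%N =
          #|[set i | bit x i != bit y i]%SET|.
  rewrite -sum1_card [RHS]big_mkcond/=; apply: eq_bigr => i _.
  by rewrite inE; case: (bit x i); case: (bit y i).
apply/cards1P/imsetP => [[i xy]|[i _ ->]]; exists i => //.
  apply: vertexP => j; rewrite bit_flip.
  by move/setP/(_ j): xy; rewrite !inE => <-; case: (bit x j); case: (bit y j).
by apply/setP => j; rewrite !inE bit_flip; case: (j == i); case: (bit x j).
Qed.

Lemma sum_transition (R : realType) y (f : vertex n -> R) :
  \sum_z transition R y z * f z = n%:R^-1 * \sum_i f (flip y i).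
Proof.
transitivity (\sum_(z in [set flip y i | i : 'I_n]%SET) n%:R^-1 * f z).
  rewrite [RHS]big_mkcond/=; apply: eq_bigr => z _.
  by rewrite /transition cube_edgeE; case: ifP => _; rewrite ?mul0r.
rewrite big_imset/= ?mulr_sumr//.
by move=> i j _ _; exact: flip_inj.
Qed.

(** The Hamming weight on [Q]: all coordinates serve for the drift, all but the last for the
    parameter [k]. *)
Definition ones Q y := (\sum_(i | Q i) (bit y i : nat))%N.

Lemma ones_count Q y : ones Q y = (\sum_(i | Q i && bit y i) 1)%N.
Proof. by rewrite /ones [RHS]big_mkcondr; apply: eq_bigr => i _; case: bit. Qed.

Lemma ones_le Q y : (ones Q y <= #|Q|)%N.
Proof.
by rewrite -sum1_card; apply: leq_sum => i _; case: bit.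
Qed.

Lemma zeros_count Q y : (\sum_(i | Q i && ~~ bit y i) 1 = #|Q| - ones Q y)%N.
Proof.
by rewrite -sum1_card [X in (X - _)%N](bigID (bit y))/= ones_count addKn.
Qed.

Lemma ones_eq0 Q y : ones Q y = 0%N -> forall i, Q i -> ~~ bit y i.
Proof.
by move=> /eqP; rewrite sum_nat_eq0 => /forall_inP y0 i /y0; rewrite eqb0.
Qed.

Lemma ones_flip_out Q y i : ~~ Q i -> ones Q (flip y i) = ones Q y.
Proof.
move=> nQi; apply: eq_bigr => j Qj; rewrite bit_flip.
by case: eqP => // ji; rewrite -ji Qj in nQi.
Qed.

Lemma ones_flip Q y i : Q i ->
  ones Q (flip y i) = if bit y i then (ones Q y).-1 else (ones Q y).+1.
Proof.
move=> Qi; rewrite /ones (bigD1 i)//= [in RHS](bigD1 i)//= bit_flip eqxx.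
under eq_bigr => j /andP[_ /negbTE ji] do rewrite bit_flip ji /=.
by case: (bit y i).
Qed.

(** Flipping a one lowers the weight and flipping a zero raises it. At weight 0 the truncated
    predecessor is multiplied by 0. *)
Lemma sum_flip (R : realType) Q y (F : nat -> R) :
  \sum_(i | Q i) F (ones Q (flip y i)) =
  (ones Q y)%:R * F (ones Q y).-1 + (#|Q| - ones Q y)%:R * F (ones Q y).+1.
Proof.
rewrite (bigID (bit y))/= -zeros_count {1}ones_count !natr_sum !mulr_suml.
by congr (_ + _); apply: eq_bigr => i /andP[Qi yi];
  rewrite mul1r ones_flip// ?yi// (negbTE yi).
Qed.

(** * A strict drift for the walk on the cube *)

Section Escape.
Variable R : realType.
Hypothesis n_gt0 : (0 < n)%N.

Let r : R := n.+1%:R^-1.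

Let r_gt0 : 0 < r. Proof. by rewrite invr_gt0. Qed.

Let r_le1 : r <= 1. Proof. by rewrite invf_le1// ler1n. Qed.

(* The rate [r] is so small that the single downward step available at weight
   one already outweighs all upward steps. *)
Lemma cube_drift y : (0 < ones predT y)%N ->
  \sum_z transition R y z * (1 - r ^+ ones predT z) <=
  1 - r ^+ ones predT y - r ^+ n.+2.
Proof.
move=> y_gt0; rewrite sum_transition (sum_flip predT y (fun k => 1 - r ^+ k)).
have := ones_le predT y; rewrite cardT size_enum_ord.
case: (ones predT y) y_gt0 => // w _ wn /=.
rewrite mulrC ler_pdivrMr ?ltr0n// natrB//.
have n0 : n%:R + 1 != 0 :> R by rewrite natr1.
have rE : r * (n%:R + 1) = 1 by rewrite natr1 mulVf// pnatr_eq0.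
have rw : r ^+ n <= r ^+ w by rewrite ler_wiXn2l// ?(ltW r_gt0)// ltnW.
have w0 : 0 <= w%:R :> R by [].
have n1 : 1 <= n%:R :> R by rewrite ler1n.
rewrite -natr1 !exprS.
(* Here the weight is [w.+1]. Replacing [r ^+ n] by the larger [r ^+ w] makes [r ^+ w] a common
   factor of the inequality. *)
suff : n%:R * r ^+ 2 * r ^+ w <=
    r ^+ w * ((w%:R + 1) + (n%:R - (w%:R + 1)) * r ^+ 2 - n%:R * r).
  have : n%:R * r ^+ 2 * r ^+ n <= n%:R * r ^+ 2 * r ^+ w.
    by rewrite ler_wpM2l// mulr_ge0// exprn_ge0// ltW.
  by rewrite expr2; nra.
rewrite mulrC ler_wpM2l ?exprn_ge0 ?(ltW r_gt0)//.
(* Eliminating [n] turns the gap into an expression in [w] and [r] whose terms are visibly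
   nonnegative. *)
have -> : n%:R = r^-1 - 1 :> R by rewrite invrK -natr1 addrK.
rewrite -subr_ge0.
have -> : w%:R + 1 + (r^-1 - 1 - (w%:R + 1)) * r ^+ 2 - (r^-1 - 1) * r -
    (r^-1 - 1) * r ^+ 2 = w%:R * (1 - r ^+ 2) + r * (1 - r).
  by field; rewrite gt_eqF.
rewrite addr_ge0// mulr_ge0 ?subr_ge0//; last exact: ltW.
by rewrite exprn_ile1// ltW.
Qed.

End Escape.

End Cube.

(** * Binomial tails and the recursion for the excess *)

Definition bin_tail n k := (\sum_(k.+1 <= i < n.+1) 'C(n, i))%N.

Lemma bin_tail0 n : bin_tail n 0 = (2 ^ n - 1)%N.
Proof.
have := expnDn 1 1 n; rewrite addn1 => ->.
under eq_bigr do rewrite !exp1n !muln1.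
by rewrite -(big_mkord xpredT (fun i => 'C(n, i))) big_ltn// bin0 addKn.
Qed.

Lemma bin_tailS n k : (k < n)%N ->
  bin_tail n k = ('C(n, k.+1) + bin_tail n k.+1)%N.
Proof. by move=> kn; rewrite /bin_tail big_ltn. Qed.

Lemma bin_tail_ge n k : (n <= k)%N -> bin_tail n k = 0%N.
Proof. by move=> nk; rewrite /bin_tail big_geq. Qed.

(** Peeling the first terms off the tails leaves [k.+2 * 'C(n, k.+2) = (n - k.+1) * 'C(n, k.+1)]. *)
Lemma bin_tail_rec n k : (k < n)%N ->
  (n.+1 * bin_tail n k.+1 =
   (n - k.+1) * bin_tail n k + k.+2 * bin_tail n k.+2)%N.
Proof.
rewrite leq_eqVlt => /predU1P[<-|kn].
  by rewrite (bin_tail_ge (leqnn _)) (bin_tail_ge (leqnSn _)) subnn !muln0.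
have := mul_bin_left n k.+1.
rewrite (bin_tailS (ltnW kn)) (bin_tailS kn) !mulnDr.
by move: 'C(n, k.+2) 'C(n, k.+1) (bin_tail n k.+2) => A B C; nia.
Qed.

Section Excess.
Variable R : realType.

Definition excess n k : R :=
  (bin_tail n k)%:R / (2 * (2 ^+ n - 1) * 'C(n.-1, k)%:R).

Lemma pow2_subr1_neq0 n : (0 < n)%N -> 2 ^+ n - 1 != 0 :> R.
Proof. by case: n => // n _; rewrite subr_eq0 gt_eqF// exprn_egt1// ltr1n. Qed.

Lemma excess0 n : (0 < n)%N -> excess n 0 = 1 / 2.
Proof.
move=> n0; rewrite /excess bin_tail0 bin0 natrB ?expn_gt0// natrX.
by field; exact: pow2_subr1_neq0.
Qed.

(** Ratios of adjacent binomials bring all three terms over the denominator with ['C(m, k.+1)]; the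
    numerators then satisfy [bin_tail_rec]. *)
Lemma excess_rec m k : (k < m)%N ->
  m.+2%:R * excess m.+1 k.+1 =
  k.+1%:R * excess m.+1 k + (m - k.+1)%:R * excess m.+1 k.+2.
Proof.
move=> km; have c0 := pow2_subr1_neq0 (ltn0Sn m).
have B0 j : (j <= m)%N -> 'C(m, j)%:R != 0 :> R.
  by move=> jm; rewrite pnatr_eq0 -lt0n bin_gt0.
have S_rec := bin_tail_rec (leqW km).
have B1 : k.+1%:R * 'C(m, k.+1)%:R = (m - k)%:R * 'C(m, k)%:R :> R.
  by rewrite -!natrM mul_bin_left.
have E1 : k.+1%:R * excess m.+1 k =
    (m - k)%:R * (bin_tail m.+1 k)%:R / (2 * (2 ^+ m.+1 - 1) * 'C(m, k.+1)%:R).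
  rewrite /excess; apply/eqP; rewrite mulrA eqr_div ?mulf_neq0 ?B0 ?(ltnW km)//.
  apply/eqP; transitivity (k.+1%:R * 'C(m, k.+1)%:R * (bin_tail m.+1 k)%:R *
      (2 * (2 ^+ m.+1 - 1)) : R); first by ring.
  by rewrite B1/=; ring.
have E2 : (m - k.+1)%:R * excess m.+1 k.+2 =
    k.+2%:R * (bin_tail m.+1 k.+2)%:R / (2 * (2 ^+ m.+1 - 1) * 'C(m, k.+1)%:R).
  (* When [k.+1 = m] the binomial ['C(m, k.+2)] in the denominator is 0, but the tail is empty and
     both sides vanish. *)
  have [km2|] := ltnP k.+1 m; last first.
    move=> mk; rewrite /excess bin_tail_ge; last by rewrite ltnS.
    by rewrite !(mul0r, mulr0).
  have B2 : k.+2%:R * 'C(m, k.+2)%:R = (m - k.+1)%:R * 'C(m, k.+1)%:R :> R.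
    by rewrite -!natrM mul_bin_left.
  rewrite /excess; apply/eqP; rewrite mulrA eqr_div ?mulf_neq0 ?B0//.
  apply/eqP; transitivity ((m - k.+1)%:R * 'C(m, k.+1)%:R *
      (bin_tail m.+1 k.+2)%:R * (2 * (2 ^+ m.+1 - 1)) : R); first by ring.
  by rewrite -B2/=; ring.
rewrite E1 E2 -mulrDl -!natrM -natrD -subSS -S_rec natrM mulrA.
by rewrite /excess.
Qed.

End Excess.

(** * The claimed probability as a harmonic function on the cube *)

Section CubeHarmonic.
Variables (R : realType) (n : nat) (hn : (1 <= n)%N).
Implicit Types y : vertex n.

Local Notation last := (last_coord hn).
Local Notation others := [pred i : 'I_n | i != last].

Definition cube_harmonic y : R :=
  if bit y last then 1 / 2 + excess R n (ones others y)
  else 1 / 2 - excess R n (ones others y).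

Lemma bit_vertex_b i : bit (vertex_b hn) i = (i == last).
Proof. by rewrite /bit ffunE. Qed.

Lemma bit_vertex_a i : bit (vertex_a n) i = false.
Proof. by rewrite /bit ffunE. Qed.

Lemma vertex_ab : vertex_a n != vertex_b hn.
Proof.
apply/eqP => /(congr1 (fun z : vertex n => bit z last)).
by rewrite bit_vertex_a bit_vertex_b eqxx.
Qed.

Lemma cube_harmonic_a : cube_harmonic (vertex_a n) = 0.
Proof.
rewrite /cube_harmonic bit_vertex_a /ones big1 => [|i _].
  by rewrite excess0// subrr.
by rewrite bit_vertex_a.
Qed.

Lemma cube_harmonic_b : cube_harmonic (vertex_b hn) = 1.
Proof.
rewrite /cube_harmonic bit_vertex_b eqxx /ones big1 => [|i /negbTE il].
  by rewrite excess0//; field.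
by rewrite bit_vertex_b il.
Qed.

(** With zero weight off the last coordinate, the last bit alone decides between [a] and [b].
    Positivity is what allows [excess_rec] to be applied. *)
Lemma ones_others_gt0 y :
  y \notin pred2 (vertex_a n) (vertex_b hn) -> (0 < ones others y)%N.
Proof.
rewrite !inE lt0n; apply: contra => /eqP /ones_eq0 y0.
have [yl|yl] := boolP (bit y last); apply/orP; [right|left]; apply/eqP/vertexP;
  move=> i; rewrite ?bit_vertex_a ?bit_vertex_b;
  have [->|il] := eqVneq i last; rewrite ?yl ?(negbTE (y0 _ il))//.
exact/negbTE.
Qed.

Lemma card_others : #|others| = n.-1.
Proof.
rewrite -[RHS](congr1 predn (card_ord n)) (cardD1 last 'I_n) inE/=.
by apply: eq_card => i; rewrite !inE andbT.
Qed.

(** Flipping the last bit reverses the sign [s] of the excess, and any other flip shifts its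
    argument by one. The constant 1/2 averages to itself, leaving [excess_rec]. *)
Lemma cube_harmonicP y : y \notin pred2 (vertex_a n) (vertex_b hn) ->
  \sum_z transition R y z * cube_harmonic z = cube_harmonic y.
Proof.
move=> /ones_others_gt0 y0; rewrite sum_transition (bigD1 last)//=.
pose s : R := if bit y last then 1 else -1.
have hE z : cube_harmonic z =
    1 / 2 + (if bit z last then 1 else -1) * excess R n (ones others z).
  by rewrite /cube_harmonic; case: bit; rewrite ?mul1r ?mulN1r.
rewrite !hE -/s bit_flip eqxx ones_flip_out ?inE ?eqxx//.
have -> : (if true (+) bit y last then 1 else -1) = - s.
  by rewrite /s; case: bit; rewrite ?opprK.
under eq_bigr => i il do
  rewrite hE bit_flip (negbTE (_ : last != i)) 1?eq_sym// -/s.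
rewrite (sum_flip others y (fun k => 1 / 2 + s * excess R n k)) card_others.
have := ones_le others y; rewrite card_others.
move: (ones others y) y0 => [//|k] _.
case: n hn => // m _ /= km.
have := excess_rec R km; rewrite natrB// -(natr1 m.+1) -(natr1 m) -(natr1 k).
move: (excess _ _ _) (excess _ _ _) (excess _ _ _) => C B A E.
have m1 : m%:R + 1 != 0 :> R by rewrite natr1.
apply: (mulfI m1); rewrite mulVKf//.
(* The term [- s * A] from flipping the last bit is split off, so that the coefficient of [A]
   becomes the one in the recursion. *)
have -> : (m%:R + 1) * (1 / 2 + s * A) =
  (m%:R + 1) / 2 - s * A + s * ((m%:R + 1 + 1) * A) by field.
by rewrite E; field.
Qed.

End CubeHarmonic.

(** * From hitting times and random variables to the finite chain *)

Lemma at_hitting_time (R : realType) d (T : measurableType d) (V : finType)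
    (X : nat -> T -> V) (a b : V) :
  at_time_event X (hitting_time R X [set a; b]) b =
  \bigcup_t first_hit X (pred2 a b) b t.
Proof.
have hitP w t : [set a; b] (X t w) <-> X t w \in pred2 a b.
  by rewrite inE; split=> [[|] ->|/orP[]/eqP ->]; rewrite ?eqxx ?orbT//; [left|right].
apply/seteqP; split=> [w [t tau Xt]|w [t _ [Xt first]]].
  exists t => //; split=> // s st; apply/negP => /hitP Xs.
  (* A visit at an earlier time [s] would force the infimum down to at most [s]. *)
  have : (hitting_time R X [set a; b] w <= s%:R%:E)%E.
    by apply: ereal_inf_lbound; exists s.
  by rewrite tau lee_fin ler_nat leqNgt st.
exists t => //; apply/eqP; rewrite eq_le; apply/andP; split.
  by apply: ereal_inf_lbound; exists t => //; apply/hitP; rewrite Xt !inE eqxx orbT.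
apply: le_ereal_inf_tmp => _ [s /hitP Xs <-]; rewrite lee_fin ler_nat leqNgt.
by apply/negP => /first; rewrite Xs.
Qed.

Section RandomWalk.
Context (R : realType) d (T : measurableType d) (P : probability T R).
Variables (n : nat) (x : vertex n) (X : nat -> {RV P >-> vertex n}).
Hypothesis walk : simple_random_walk P X x.

Let Y t : T -> vertex n := X t.

Lemma measurable_walk t v : measurable (Y t @^-1` [set v]).
Proof. by rewrite -[_ @^-1` _]setTI; exact: measurable_funP. Qed.

(** Clears the denominator of the conditional probability, treating null histories separately. *)
Lemma walk_markov t (p : {ffun 'I_t.+1 -> vertex n}) z :
  pr P (history Y t @^-1` [set p] `&` Y t.+1 @^-1` [set z]) =
  pr P (history Y t @^-1` [set p]) * transition R (p ord_max) z.
Proof.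
have mH := measurable_history measurable_walk p.
(* [inord] extends the finite path to all times; its default values occur only after [t], outside
   the history event. *)
have [_ /(_ t (p \o inord) z)] := walk.
have -> : [set w | forall s, (s <= t)%N -> X s w = (p \o inord) s] =
    history Y t @^-1` [set p].
  apply/seteqP; split=> [w /= Xp|w /= <- s st].
    by apply/ffunP => i; rewrite ffunE; apply: etrans (Xp i _) _;
      rewrite /= ?inord_val// -ltnS ltn_ord.
  by rewrite ffunE /= inordK.
have -> : (p \o inord) t = p ord_max.
  by rewrite /=; congr (p _); apply/val_inj; rewrite /= inordK.
rewrite /cond_prob -/(pr P _) setIC -/(pr P _) prE// eqe.
(* On a null history the intersection is null by monotonicity, so both sides are 0. *)
have [H0 _|H0 <-//] := eqVneq (pr P (history Y t @^-1` [set p])) 0.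
  rewrite H0 mul0r; apply/eqP; rewrite eq_le pr_ge0 andbT -H0 le_pr//.
  by apply: measurableI => //; exact: measurable_walk.
by rewrite mulrC divfK.
Qed.

Lemma walk_start (f : vertex n -> R) :
  \sum_y pr P (Y 0 @^-1` [set y]) * f y = f x.
Proof.
have [P0 _] := walk.
rewrite (bigD1 x)//= {1}/pr P0 mul1r big1 ?addr0// => y /eqP yx.
have m0 := measurable_walk 0.
rewrite -(pr_setI_full (m0 y) (m0 x) P0) (_ : _ `&` _ = set0).
  by rewrite pr_set0 mul0r.
by apply/seteqP; split=> // w [/= wy wx]; case: yx; rewrite -wy.
Qed.

(** The conditioning event has probability 1, so the quotient is the plain probability. *)
Lemma hit_probE (a b : vertex n) :
  hit_prob P X a b x = pr P (\bigcup_t first_hit Y (pred2 a b) b t).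
Proof.
have [P0 _] := walk.
rewrite /hit_prob /cond_prob at_hitting_time -/(pr P _) P0 divr1 pr_setI_full//.
  exact/measurable_bigcup_first_hit/measurable_walk.
exact: measurable_walk.
Qed.

End RandomWalk.

Theorem theorem1 (R : realType) (d : measure_display) (T : measurableType d)
    (P : probability T R) (n : nat) (hn : (1 <= n)%N) (x : vertex n)
    (X : nat -> {RV P >-> vertex n}) :
  simple_random_walk P X x ->
  let k := (\sum_(i < n | i != last_coord hn) (bit x i : nat))%N in
  let c : R := (\sum_(k.+1 <= i < n.+1) 'C(n, i))%N%:R
               / (2 * (2 ^+ n - 1) * 'C(n.-1, k)%:R) in
  hit_prob P X (vertex_a n) (vertex_b hn) x =
    if bit x (last_coord hn) then 1 / 2 + c else 1 / 2 - c.
Proof.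
move=> walk k c; rewrite (hit_probE walk).
rewrite (hitting_harmonic (measurable_walk X) (walk_markov walk)
  (h := cube_harmonic R hn)); first exact: (walk_start walk).
- by rewrite !inE eqxx orbT.
- move=> v; rewrite !inE => /orP[]/eqP ->; last by rewrite cube_harmonic_b eqxx.
  by rewrite cube_harmonic_a (negbTE (vertex_ab hn)).
- exact: cube_harmonicP.
(* What remains is that survival vanishes; the drift function is [1 - r ^+ |v|] with [r = 1/(n+1)],
   and the loss per step is [r ^+ n.+2]. *)
have r0 : 0 < n.+1%:R^-1 :> R by rewrite invr_gt0.
apply: (survive_lt (measurable_walk X) (walk_markov walk)
  (g := fun v => 1 - n.+1%:R^-1 ^+ ones predT v) (eps := n.+1%:R^-1 ^+ n.+2)).
- by move=> v; rewrite subr_ge0 exprn_ile1 ?invf_le1 ?ler1n// ltW.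
- exact: exprn_gt0.
(* A one outside the last coordinate makes the total weight positive, as the drift bound
   requires. *)
- move=> y /ones_others_gt0 y0; apply: cube_drift => //.
  apply: leq_trans y0 _; rewrite /ones [X in (_ <= X)%N](bigID (predC1 (last_coord hn)))/=.
  exact: leq_addr.
- by move=> y z; rewrite /transition; case: ifP.
Qed.
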